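(* For every positive integer $n$ there exists a complete geometric graph on $n$ points whose edge set can be partitioned into $\lceil n/2\rceil+1$ plane star-forests.
   Context: A complete geometric graph on a finite point set $P\subset\mathbb{R}^2$ in general position (no three collinear) is the complete graph on $P$ with edges drawn as straight line segments. A subgraph is plane if no two of its edges cross. A star is a connected graph with one vertex (the center) adjacent to all other vertices and no other edges; a star-forest is a forest each of whose components is a star. *)

(* Defs.v *)
From HB Require Import structures.
From mathcomp Require Import all_boot all_order all_algebra.
From mathcomp Require Import reals.
Set Implicit Arguments.
Unset Strict Implicit.
Unset Printing Implicit Defensive.
Import Order.TTheory GRing.Theory Num.Theory.
Local Open Scope ring_scope.

(* A graph on the finite vertex type V is given by its edge set, an edge being
   a two-element subset of V; vertices on no edge are isolated vertices. *)
Definition complete_edges (V : finType) : {set {set V}} :=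
  [set e : {set V} | #|e| == 2%N].

Definition adj (V : finType) (E : {set {set V}}) : rel V :=
  [rel u v | (u != v) && ([set u; v] \in E)].

Definition component (V : finType) (E : {set {set V}}) (u : V) : {set V} :=
  [set v | connect (adj E) u v].

Definition forest (V : finType) (E : {set {set V}}) : Prop :=
  forall c : seq V, (2 < size c)%N -> ~ ucycle (adj E) c.

(* The subgraph induced on C is a star. Only used with C a connected component,
   so connectedness is not restated; a single vertex is a star. *)
Definition star_on (V : finType) (E : {set {set V}}) (C : {set V}) : Prop :=
  exists2 c : V, c \in C &
    (forall v, v \in C -> v != c -> adj E c v) /\
    (forall u v, u \in C -> v \in C -> adj E u v -> u = c \/ v = c).

Definition star_forest (V : finType) (E : {set {set V}}) : Prop :=
  forest E /\ forall u : V, star_on E (component E u).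

(* Classes may be empty: this is unavoidable when there are fewer edges than
   classes, e.g. for one or two vertices. *)
Definition edge_partition (V I : finType) (F : I -> {set {set V}}) : Prop :=
  \bigcup_i F i = complete_edges V /\
  forall i j : I, i != j -> [disjoint F i & F j].

Definition collinear (R : realType) (a b c : 'rV[R]_2) : Prop :=
  exists o d : 'rV[R]_2, d != 0 /\
    forall x, x \in [:: a; b; c] -> exists t : R, x = o + t *: d.

Definition general_position (R : realType) (V : finType)
    (p : V -> 'rV[R]_2) : Prop :=
  injective p /\
  forall u v w : V, uniq [:: u; v; w] -> ~ collinear (p u) (p v) (p w).

Definition edge_interior (R : realType) (V : finType) (p : V -> 'rV[R]_2)
    (e : {set V}) (x : 'rV[R]_2) : Prop :=
  exists u v : V, exists t : R,
    [/\ u != v, e = [set u; v], 0 < t < 1 & x = (1 - t) *: p u + t *: p v].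

(* For points in general position, distinct edges whose relative interiors meet
   share no endpoint and cross properly. *)
Definition crossing (R : realType) (V : finType) (p : V -> 'rV[R]_2)
    (e f : {set V}) : Prop :=
  e != f /\ exists x, edge_interior p e x /\ edge_interior p f x.

Definition plane (R : realType) (V : finType) (p : V -> 'rV[R]_2)
    (E : {set {set V}}) : Prop :=
  forall e f : {set V}, e \in E -> f \in E -> ~ crossing p e f.

(* Main.v *)
Require Import Defs.
From HB Require Import structures.
From mathcomp Require Import all_boot all_order all_algebra.
From mathcomp Require Import reals.
From mathcomp Require Import zify ring lra.
Set Implicit Arguments.
Unset Strict Implicit.
Unset Printing Implicit Defensive.
Import Order.TTheory GRing.Theory Num.Theory.
Local Open Scope ring_scope.

(* Put [eps_k = 4^-k], [a_k = (3k+3) (1, k - 2/3)] and [b_k = - eps_k (1, k)].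
   The points [a_k] lie on a parabola on the right, and the points [b_k]
   converge geometrically to the origin from the left, so that
     slope (b_j, b_k) is in [j - 1/3, j) for j < k, and
     slope (b_j, a_k) is in (k - 1, k - 1/3) for all j and k;
   since these intervals are disjoint, the points are in general position.
   The line [l_k] of slope [k - 5/6] through the origin separates [a_i] from
   [b_i] for every i, with [a_i] on top iff [k <= i].  Class k consists of the
   star from [a_k] to the points on its side of [l_k] and the star from [b_k] to
   the points on the other side.  For i < j this puts [a_i a_j] and [b_i b_j] in
   class i, and [a_i b_j] and [b_i a_j] in class j.  The remaining edges
   [a_k b_k] form a matching, which is plane because all the points of index
   greater than k lie above the line through [a_k] and [b_k].  For odd n the
   last [b] is missing. *)

(** * Star-forests described by a centre map *)

Section StarForests.
Variables (V : finType) (E : {set {set V}}).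

Lemma adjC u v : adj E u v = adj E v u.
Proof. by rewrite /adj /= eq_sym setUC. Qed.

(** [c u] stands for the centre of the star containing [u]; the hypotheses force an isolated vertex
    to be its own centre. *)
Variable c : V -> V.
Hypothesis c_adj : forall u v, adj E u v -> c u = c v.
Hypothesis c_end : forall u v, adj E u v -> u = c u \/ v = c v.
Hypothesis c_nbr : forall u, u != c u -> adj E (c u) u.

(** Otherwise both ends of the path would be the centre [c v], hence equal. *)
Lemma center_path_mid u v w : adj E u v -> adj E v w -> u != w -> v = c v.
Proof.
move=> uv vw; case: (c_end uv) => // uc; case: (c_end vw) => // wc.
by rewrite uc wc (c_adj uv) (c_adj vw) eqxx.
Qed.

(** A cycle would contain two consecutive vertices that are both centres of the same star. A
    component is a star because [c] is constant on it. *)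
Lemma center_star_forest : star_forest E.
Proof.
split.
  move=> [|x [|y [|z s]]] //= _ /andP[/= /and3P[xy yz pz]].
  rewrite !inE !negb_or => /and3P[/and3P[x_y x_z x_s] /andP[y_z y_s] _].
  have yc := center_path_mid xy yz x_z.
  (* The successor of [z] on the cycle is [x] in a triangle and [t] otherwise. *)
  have zc : z = c z.
    move: pz; rewrite rcons_path; case: s x_s y_s => [|t s] /=.
      by move=> _ _ zx; apply: center_path_mid yz zx _; rewrite eq_sym.
    rewrite !inE !negb_or => _ /andP[yt _] /andP[/andP[zt _] _].
    exact: center_path_mid yz zt yt.
  by move: y_z; rewrite yc zc (c_adj yz) eqxx.
move=> u.
have cE v : v \in component E u -> c v = c u.
  rewrite inE => /connectP[p + ->]; elim: p u => //= w p IH u /andP[uw /IH ->].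
  by rewrite (c_adj uw).
have cu : c u \in component E u.
  rewrite inE; have [<-|/c_nbr] := eqVneq u (c u); first exact: connect0.
  by rewrite adjC => /connect1.
exists (c u) => //; split=> [v /cE cv vu|v w /cE cv /cE cw /c_end].
  by rewrite -cv; apply: c_nbr; rewrite cv.
by rewrite cv cw.
Qed.
End StarForests.

(** * Orientation of triples and comparison of slopes *)

Section Plane.
Variable R : realType.
Implicit Types p q r s x : 'rV[R]_2.

(** Twice the signed area of the triangle, positive when it is counterclockwise. *)
Definition orient p q r : R :=
  (q 0 0 - p 0 0) * (r 0 1 - p 0 1) - (q 0 1 - p 0 1) * (r 0 0 - p 0 0).

Lemma collinear_orient p q r : collinear p q r -> orient p q r = 0.
Proof.
move=> [o [d [_ H]]].
have [|tp ->] := H p; first by rewrite !inE eqxx.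
have [|tq ->] := H q; first by rewrite !inE eqxx orbT.
have [|tr ->] := H r; first by rewrite !inE eqxx !orbT.
by rewrite /orient !mxE; ring.
Qed.

Lemma orientC12 p q r : orient q p r = - orient p q r.
Proof. by rewrite /orient; ring. Qed.

Lemma orientC23 p q r : orient p r q = - orient p q r.
Proof. by rewrite /orient; ring. Qed.

Lemma orient_seg p q r s (t : R) :
  orient p q ((1 - t) *: r + t *: s) =
  (1 - t) * orient p q r + t * orient p q s.
Proof. by rewrite /orient !mxE; ring. Qed.

Lemma seg_pos (a b t : R) : 0 < t < 1 -> 0 < a -> 0 < b ->
  0 < (1 - t) * a + t * b.
Proof.
by move=> /andP[t0 t1] a0 b0; rewrite addr_gt0 // mulr_gt0 // subr_gt0.
Qed.

(* Here [B / A < s <= D / C] compares the slopes of two vectors pointing to the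
   right. *)
Lemma slope_lt (A B C D s : R) : 0 < A -> 0 < C -> B < s * A -> s * C <= D ->
  0 < A * D - B * C.
Proof.
move=> A0 C0 BA CD.
have h1 : 0 < (s * A - B) * C by rewrite mulr_gt0 // subr_gt0.
have h2 : 0 <= A * (D - s * C) by rewrite mulr_ge0 ?subr_ge0 // ltW.
lra.
Qed.

(** * The points and the slopes between them *)

Definition eps (k : nat) : R := 4%:R ^- k.

Lemma eps_gt0 k : 0 < eps k.
Proof. by rewrite invr_gt0 exprn_gt0 // ltr0n. Qed.

Lemma epsS k : eps k = 4%:R * eps k.+1.
Proof.
by rewrite /eps exprS invfM mulrA divff ?mul1r // pnatr_eq0.
Qed.

(** Bernoulli's inequality [1 + 3 d <= 4^d], scaled. The factor 3 is what yields the lower bound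
    [j - 1/3] for the slope from [b_j] to a later [b_k]. *)
Lemma eps_gap j d : 3%:R * d%:R * eps (j + d) <= eps j - eps (j + d).
Proof.
elim: d => [|d IH]; first by rewrite addn0 !(mulr0, mul0r) subrr.
have := epsS (j + d); rewrite addnS -[d.+1%:R]natr1.
move: IH (eps_gt0 (j + d).+1); move: (eps _.+1) => e + e0 E; rewrite {}E.
have : 0 <= d%:R * e by rewrite mulr_ge0 // ltW.
nra.
Qed.

Lemma eps_gap_lt j k : (j < k)%N ->
  3%:R * (k%:R - j%:R) * eps k <= eps j - eps k.
Proof.
move=> jk; have := eps_gap j (k - j).
by rewrite subnKC ?natrB // ltnW.
Qed.

Lemma eps_decr j k : (j < k)%N -> eps k < eps j.
Proof.
move=> jk; have := eps_gap_lt jk; rewrite -(ltr_nat R) in jk.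
have : 0 < (k%:R - j%:R) * eps k by rewrite mulr_gt0 ?subr_gt0 ?eps_gt0.
nra.
Qed.

Lemma eps_le1 k : eps k <= 1 /\ 3%:R * (k%:R * eps k) <= 1 - eps k.
Proof.
have := eps_gap 0 k; rewrite add0n /eps expr0 invr1 -/(eps k).
have := eps_gt0 k; have : 0 <= k%:R * eps k.
  by rewrite mulr_ge0 // ltW // eps_gt0.
split; nra.
Qed.

(* The pairs [a_k], [b_k] of the header are the vertices [2k] and [2k+1]. *)
Definition abscissa (v : nat) : R :=
  if odd v then - eps v./2 else 3%:R * v./2%:R + 3%:R.

Definition ordinate (v : nat) : R :=
  if odd v then - (v./2%:R * eps v./2)
  else (v./2%:R + 1) * (3%:R * v./2%:R - 2%:R).

Definition pt (v : nat) : 'rV[R]_2 :=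
  \row_j (if j == 0 then abscissa v else ordinate v).

Lemma orient_pt u v w : orient (pt u) (pt v) (pt w) =
  (abscissa v - abscissa u) * (ordinate w - ordinate u) -
  (ordinate v - ordinate u) * (abscissa w - abscissa u).
Proof. by rewrite /orient !mxE. Qed.

Lemma slope_bb u v : odd u -> odd v -> (u./2 < v./2)%N ->
  [/\ 0 < abscissa v - abscissa u,
      (u./2%:R - 3%:R^-1) * (abscissa v - abscissa u)
        <= ordinate v - ordinate u &
      ordinate v - ordinate u < u./2%:R * (abscissa v - abscissa u)].
Proof.
rewrite /abscissa /ordinate => -> -> uv.
have h1 := eps_gap_lt uv; have h2 := eps_decr uv.
rewrite -(ltr_nat R) -subr_gt0 in uv.
have h3 := mulr_gt0 uv (eps_gt0 v./2).
split; nra.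
Qed.

(** Seen from the origin, [a_k] has slope exactly [k - 2/3]. Each [b_j] is so close to the origin
    ([eps j <= 1] and [j eps j <= 1/3]) that the slope changes by less than [1/3]. *)
Lemma slope_ba u v : odd u -> ~~ odd v ->
  [/\ 0 < abscissa v - abscissa u,
      (v./2%:R - 1) * (abscissa v - abscissa u) < ordinate v - ordinate u &
      ordinate v - ordinate u
        < (v./2%:R - 3%:R^-1) * (abscissa v - abscissa u)].
Proof.
rewrite /abscissa /ordinate => -> /negbTE ->.
have [e1 e2] := eps_le1 u./2; have e0 := eps_gt0 u./2.
move: (eps _) e0 e1 e2 => e e0 e1 e2.
have k0 : 0 <= v./2%:R :> R by [].
have l0 : 0 <= u./2%:R :> R by [].
have le0 : 0 <= u./2%:R * e by rewrite mulr_ge0 // ltW.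
have ke : v./2%:R * e <= v./2%:R by rewrite ler_piMr.
have ke0 : 0 <= v./2%:R * e by rewrite mulr_ge0 // ltW.
move: v./2%:R u./2%:R k0 l0 e2 le0 ke ke0 => k l k0 l0 e2 le0 ke ke0.
split; lra.
Qed.

Lemma natr_le_pred (i j : nat) : (i < j)%N -> i%:R <= j%:R - 1 :> R.
Proof. by move=> ij; rewrite lerBrDr natr1 ler_nat. Qed.

(** * General position *)

Lemma orient_bbb u v w : odd u -> odd v -> odd w ->
  (u./2 < v./2)%N -> (v./2 < w./2)%N -> 0 < orient (pt u) (pt v) (pt w).
Proof.
move=> ou ov ow uv vw; have [x1 _ y1] := slope_bb ou ov uv.
have [x2 y2 _] := slope_bb ov ow vw.
(* The slopes compared are those of the consecutive steps from [u] to [v] and from [v] to [w]; their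
   determinant equals the orientation of the triple. *)
have := slope_lt x1 x2 y1 (D := ordinate w - ordinate v).
rewrite orient_pt => H; have /H : u./2%:R * (abscissa w - abscissa v) <=
  ordinate w - ordinate v.
  apply: le_trans y2; rewrite ler_wpM2r //; first exact: ltW.
  by have := natr_le_pred uv; lra.
lra.
Qed.

Lemma orient_bab u v w : odd u -> ~~ odd v -> odd w ->
  (u./2 < w./2)%N -> (v./2 <= u./2)%N -> 0 < orient (pt u) (pt v) (pt w).
Proof.
move=> ou ov ow uw vu; have [x1 _ y1] := slope_ba ou ov.
have [x2 y2 _] := slope_bb ou ow uw.
rewrite orient_pt; apply: (slope_lt x1 x2 y1); apply: le_trans y2.
by rewrite ler_wpM2r ?(ltW x2) // lerD2r ler_nat.
Qed.

Lemma orient_bba u v w : odd u -> odd v -> ~~ odd w ->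
  (u./2 < v./2)%N -> (u./2 < w./2)%N -> 0 < orient (pt u) (pt v) (pt w).
Proof.
move=> ou ov ow uv uw; have [x1 _ y1] := slope_bb ou ov uv.
have [x2 y2 _] := slope_ba ou ow.
rewrite orient_pt; apply: (slope_lt x1 x2 y1); apply: le_trans (ltW y2).
by rewrite ler_wpM2r ?(ltW x2) // natr_le_pred.
Qed.

Lemma orient_baa u v w : odd u -> ~~ odd v -> ~~ odd w ->
  (v./2 < w./2)%N -> 0 < orient (pt u) (pt v) (pt w).
Proof.
move=> ou ov ow vw; have [x1 _ y1] := slope_ba ou ov.
have [x2 y2 _] := slope_ba ou ow.
rewrite orient_pt; apply: (slope_lt x1 x2 y1); apply: le_trans (ltW y2).
rewrite ler_wpM2r ?(ltW x2) //; have := natr_le_pred vw; lra.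
Qed.

Lemma orient_aaa u v w : ~~ odd u -> ~~ odd v -> ~~ odd w ->
  u./2 != v./2 -> v./2 != w./2 -> u./2 != w./2 ->
  orient (pt u) (pt v) (pt w) != 0.
Proof.
rewrite orient_pt /abscissa /ordinate.
move=> /negbTE-> /negbTE-> /negbTE-> uv vw uw.
(* A Vandermonde product, since the points [a_k] lie on a parabola. *)
rewrite [X in X != 0](_ : _ = 9%:R * (v./2%:R - u./2%:R) *
  (w./2%:R - u./2%:R) * (w./2%:R - v./2%:R)); last by ring.
by rewrite !mulf_neq0 ?pnatr_eq0 // subr_eq0 eqr_nat // eq_sym.
Qed.

Lemma orient_pt_sorted u v w : (odd w <= odd v <= odd u)%N ->
  (odd u = odd v -> (u./2 < v./2)%N) -> (odd v = odd w -> (v./2 < w./2)%N) ->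
  orient (pt u) (pt v) (pt w) != 0.
Proof.
case ou: (odd u); case ov: (odd v); case ow: (odd w) => //= _ uv vw.
- by apply/lt0r_neq0/orient_bbb; rewrite ?ou ?ov ?ow ?uv ?vw.
- have [uw|wu] := ltnP u./2 w./2.
    by apply/lt0r_neq0/orient_bba; rewrite ?ou ?ov ?ow ?uv.
  (* Here the step from [b_u] to [a_w] is less steep than the one to [b_v], so the orientation is
     negative. *)
  rewrite -oppr_eq0 -orientC23.
  by apply/lt0r_neq0/orient_bab; rewrite ?ou ?ov ?ow ?uv.
- by apply/lt0r_neq0/orient_baa; rewrite ?ou ?ov ?ow ?vw.
- have := uv erefl; have := vw erefl => vw' uv'.
  by apply: orient_aaa; rewrite ?ou ?ov ?ow ?ltn_eqF // (ltn_trans uv').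
Qed.

Lemma orient_pt_neq0 u v w : uniq [:: u; v; w] ->
  orient (pt u) (pt v) (pt w) != 0.
Proof.
rewrite /= !inE negb_or andbT => /andP[/andP[uv uw] vw].
(* [r] puts every [b] before every [a] and sorts by index within each kind. Permuting a triple
   changes at most the sign of [orient], so sorted triples suffice. *)
pose r a b := (odd b < odd a)%N || (odd a == odd b) && (a./2 < b./2)%N.
have r_sorted a b c : r a b -> r b c -> orient (pt a) (pt b) (pt c) != 0.
  rewrite /r => ab bc; apply: orient_pt_sorted; move: ab bc;
    by case: (odd a); case: (odd b); case: (odd c) => //= ->.
have r_total a b : a != b -> r a b || r b a by rewrite /r; lia.
have r_trans a b c : r a b -> r b c -> r a c.
  rewrite /r; case: (odd a); case: (odd b); case: (odd c) => //=;
    exact: ltn_trans.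
have nC12 a b c : orient a b c != 0 -> orient b a c != 0.
  by rewrite orientC12 oppr_eq0.
have nC23 a b c : orient a b c != 0 -> orient a c b != 0.
  by rewrite orientC23 oppr_eq0.
case/orP: (r_total _ _ uv) => uv'; case/orP: (r_total _ _ vw) => vw'.
- exact: r_sorted uv' vw'.
- case/orP: (r_total _ _ uw) => uw'; apply: nC23; first exact: r_sorted uw' vw'.
  by apply: nC12; exact: r_sorted uw' uv'.
- case/orP: (r_total _ _ uw) => uw'; apply: nC12; first exact: r_sorted uv' uw'.
  by apply: nC23; exact: r_sorted vw' uw'.
- by apply/nC12/nC23/nC12; exact: r_sorted vw' uv'.
Qed.

Lemma pt_inj : injective pt.
Proof.
move=> u v /rowP/(_ 0); rewrite !mxE /= /abscissa.
have eps_inj : injective eps.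
  move=> i j ij; case: (ltngtP i j) => // /eps_decr; by rewrite ij ltxx.
have a_gt0 k : 0 < 3%:R * k%:R + 3%:R :> R by rewrite ltr_wpDl ?mulr_ge0.
case ou: (odd u); case ov: (odd v).
- by move=> /oppr_inj/eps_inj; lia.
- by move=> E; exfalso; have := eps_gt0 u./2; have := a_gt0 v./2; lra.
- by move=> E; exfalso; have := eps_gt0 v./2; have := a_gt0 u./2; lra.
- move=> /addIr/(mulfI _)/eqP; rewrite pnatr_eq0 eqr_nat => /(_ isT)/eqP; lia.
Qed.

Lemma pt_general_position n : general_position (fun i : 'I_n => pt i).
Proof.
split=> [i j /pt_inj/val_inj//|u v w Huniq /collinear_orient /eqP].
apply/negP/orient_pt_neq0.
by rewrite -(map_inj_uniq val_inj) in Huniq.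
Qed.

(** * Separating lines and disjoint segments *)

Lemma orient_pair_gt0 i w : (i < w./2)%N ->
  0 < orient (pt i.*2.+1) (pt i.*2) (pt w).
Proof.
move=> iw; case ow: (odd w).
  by apply: orient_bab; rewrite //= ?odd_double ?uphalf_double ?doubleK.
by apply: orient_baa; rewrite //= ?odd_double ?ow ?doubleK.
Qed.

(* [side k v] tells whether [pt v] lies above the line [l_k] of slope
   [k - 5/6] through the origin. *)
Definition side (k v : nat) : bool := odd v (+) (k <= v./2)%N.

(** Vertical offset of [q] from [l_k]. It is affine in [q], so a sign shared by two endpoints holds
    along the segment. *)
Definition height (k : nat) (q : 'rV[R]_2) : R :=
  q 0 1 - (k%:R - 5%:R / 6%:R) * q 0 0.

Lemma height_seg k q r (t : R) :
  height k ((1 - t) *: q + t *: r) = (1 - t) * height k q + t * height k r.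
Proof. by rewrite /height !mxE; ring. Qed.

(** The height is [(k - l - 5/6) eps l] at [b_l] and [(l + 1) (3 (l - k) + 1/2)] at [a_l]. For
    integers [k] and [l] neither vanishes, and the sign depends only on whether [k <= l]. *)
Lemma height_side k v : 0 < (-1) ^+ (~~ side k v) * height k (pt v).
Proof.
rewrite /height !mxE /= /abscissa /ordinate /side.
have e0 := eps_gt0 v./2; have h0 : 0 <= v./2%:R :> R by [].
case: (odd v) => /=; case: (leqP k v./2) => /= kv;
  rewrite ?expr0 ?expr1 ?mul1r ?mulN1r.
- rewrite -(ler_nat R) in kv; set e := eps _ in e0 *.
  have : 0 <= (v./2%:R - k%:R) * e by rewrite mulr_ge0 ?subr_ge0 // ltW.
  lra.
- have := natr_le_pred kv; set e := eps _ in e0 * => kv'.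
  have : 0 <= (k%:R - 1 - v./2%:R) * e by rewrite mulr_ge0 ?subr_ge0 // ltW.
  lra.
- rewrite -(ler_nat R) in kv.
  have : 0 <= (v./2%:R - k%:R) * (v./2%:R + 1) :> R.
    by rewrite mulr_ge0 ?subr_ge0 // addr_ge0.
  nra.
- have := natr_le_pred kv => kv'.
  have : 0 <= (k%:R - 1 - v./2%:R) * (v./2%:R + 1) :> R.
    by rewrite mulr_ge0 ?subr_ge0 // addr_ge0.
  nra.
Qed.

Lemma seg_side k u v (t : R) : 0 < t < 1 -> side k u = side k v ->
  0 < (-1) ^+ (~~ side k u) * height k ((1 - t) *: pt u + t *: pt v).
Proof.
move=> t01 uv; rewrite height_seg mulrDr mulrCA [_ * (t * _)]mulrCA.
by apply: seg_pos => //; [|rewrite uv]; exact: height_side.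
Qed.

(** Orientation with respect to [u] and [v] vanishes on the first segment, but at the point of the
    second it is [s] times a nonzero number. *)
Lemma seg_common_end u v w (t s : R) : uniq [:: u; v; w] -> 0 < s ->
  (1 - t) *: pt u + t *: pt v <> (1 - s) *: pt u + s *: pt w.
Proof.
move=> /orient_pt_neq0 nz s0 /(congr1 (orient (pt u) (pt v))).
have orient0 p q : orient p q p = 0 /\ orient p q q = 0.
  by rewrite /orient; split; ring.
rewrite !orient_seg; have [-> ->] := orient0 (pt u) (pt v).
move/eqP; rewrite !mulr0 !add0r eq_sym mulf_eq0 (negbTE nz) orbF.
by rewrite gt_eqF.
Qed.

Lemma seg_opposite_sides k u v w z (t s : R) : 0 < t < 1 -> 0 < s < 1 ->
  side k u = side k v -> side k w = side k z -> side k u != side k w ->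
  (1 - t) *: pt u + t *: pt v <> (1 - s) *: pt w + s *: pt z.
Proof.
move=> t01 s01 uv wz + E; have := seg_side t01 uv; have := seg_side s01 wz.
rewrite E; case: (side k u); case: (side k w) => //=;
  rewrite ?expr0 ?expr1 ?mul1r ?mulN1r; lra.
Qed.

(** The line through the pair of smaller index contains the first segment and has the second
    strictly on one side. *)
Lemma seg_pairs u v w z (t s : R) : 0 < s < 1 ->
  u./2 = v./2 -> w./2 = z./2 -> (u./2 < w./2)%N ->
  (1 - t) *: pt u + t *: pt v <> (1 - s) *: pt w + s *: pt z.
Proof.
move=> s01 uv wz uw /(congr1 (orient (pt u./2.*2.+1) (pt u./2.*2))).
have pair0 y : y./2 = u./2 ->
    orient (pt u./2.*2.+1) (pt u./2.*2) (pt y) = 0.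
  move=> <-; have [->|->] : y = y./2.*2.+1 \/ y = y./2.*2 by lia.
    by rewrite /= uphalf_double /orient; ring.
  by rewrite doubleK /orient; ring.
have uz : (u./2 < z./2)%N by rewrite -wz.
rewrite !orient_seg (pair0 u) // (pair0 v) // !mulr0 addr0 => E.
have := seg_pos s01 (orient_pair_gt0 uw) (orient_pair_gt0 uz).
by rewrite -E ltxx.
Qed.

End Plane.

(** * The edge colouring and the stars of its classes *)

Section Colouring.
Variable n : nat.
Implicit Types u v w : 'I_n.

(** Indices of pairs are below [uphalf n], which leaves that value free for the matching. *)
Definition colour (u v : nat) : nat :=
  if u./2 == v./2 then uphalf n
  else if odd u == odd v then minn u./2 v./2 else maxn u./2 v./2.

Lemma colourC u v : colour u v = colour v u.
Proof. by rewrite /colour eq_sym (eq_sym (odd u)) minnC maxnC. Qed.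

Lemma half_ltn u : (u./2 < uphalf n)%N.
Proof. have := ltn_ord u; lia. Qed.

Lemma colour_le u v : (colour u v <= uphalf n)%N.
Proof.
have := half_ltn u; have := half_ltn v; rewrite /colour.
case: ifP => // _; case: ifP; lia.
Qed.

Lemma colour_matching u v : colour u v = uphalf n -> u./2 = v./2.
Proof.
have := half_ltn u; have := half_ltn v; rewrite /colour.
case: ifP => [/eqP //|_]; case: ifP; lia.
Qed.

(** With equal parities both indices are at least [k]; with opposite parities one is [k] and the
    other is smaller. Either way the two terms of [side] balance. *)
Lemma colour_star k u v : (k < uphalf n)%N -> colour u v = k ->
  side k u = side k v /\ (u./2 = k \/ v./2 = k).
Proof.
move=> kn; rewrite /colour /side; case: ifP => [_|]; first by lia.
by case: ifP; lia.
Qed.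

Definition colour_class (k : nat) : {set {set 'I_n}} :=
  [set e : {set 'I_n} | [exists u, exists v,
    [&& u != v, e == [set u; v] & colour u v == k]]].

Lemma colour_classP k (e : {set 'I_n}) :
  reflect (exists u v, [/\ u != v, e = [set u; v] & colour u v = k])
    (e \in colour_class k).
Proof.
rewrite inE; apply: (iffP existsP) => -[u].
  by case/existsP=> v /and3P[uv /eqP -> /eqP cuv]; exists u, v.
by case=> v [uv -> <-]; exists u; apply/existsP; exists v; rewrite uv !eqxx.
Qed.

Lemma set2_eq (T : finType) (u v w z : T) : [set u; v] = [set w; z] ->
  u = w /\ v = z \/ u = z /\ v = w.
Proof.
move=> /setP E; have := E u; have := E v; have := E w; have := E z.
rewrite !inE !eqxx ?orbT /=.
by move=> /orP[]/eqP ? /orP[]/eqP ? /esym/orP[]/eqP ? /esym/orP[]/eqP ?;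
  subst; auto.
Qed.

Lemma colour_class_pair k u v : u != v ->
  ([set u; v] \in colour_class k) = (colour u v == k).
Proof.
move=> uv; apply/colour_classP/eqP=> [[w [z [_ /set2_eq E <-]]]|<-]; last first.
  by exists u, v.
by case: E => -[-> ->]; rewrite // colourC.
Qed.

Lemma adj_colour k u v :
  adj (colour_class k) u v = (u != v) && (colour u v == k).
Proof. by rewrite /adj /=; case: eqVneq => //= uv; rewrite colour_class_pair. Qed.

Lemma colour_partition :
  edge_partition (fun k : 'I_(uphalf n + 1) => colour_class k).
Proof.
split=> [|i j ij].
  apply/setP=> e; rewrite inE; apply/bigcupP/cards2P.
    by case=> k _ /colour_classP[u [v [uv -> _]]]; exists u, v.
  case=> u [v [uv ->]].
  have h : (colour u v < uphalf n + 1)%N by rewrite addn1 ltnS colour_le.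
  by exists (Ordinal h) => //; rewrite colour_class_pair.
apply/pred0P=> e /=; apply/negP=> /andP[/colour_classP[u [v [uv -> cuv]]]].
by rewrite colour_class_pair // cuv => /eqP/val_inj/eqP; apply/negP.
Qed.

(* [insubd] returns [u] itself when the partner [b] of the last [a] is
   missing. *)
Definition centre (k : nat) (u : 'I_n) : 'I_n :=
  insubd u (if k == uphalf n then u./2.*2
            else k.*2 + (odd u (+) (u./2 < k))%N)%N.

(** The even vertex of a pair is at most [u], so [insubd] never falls back on its default. *)
Lemma centre_matching u : centre (uphalf n) u = u./2.*2 :> nat.
Proof.
rewrite val_insubd eqxx; case: ifP => // /negP[].
by apply: leq_ltn_trans (ltn_ord u); rewrite -{2}(odd_double_half u) leq_addl.
Qed.

(** This accounts for the parity bit in [centre]: it selects the vertex of index [k] on the side of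
    [u]. *)
Lemma side_parity k w (u : nat) : w./2 = k ->
  (side k u == side k w) = (odd w == odd u (+) (u./2 < k)%N).
Proof.
rewrite /side => ->; rewrite leqnn ltnNge.
by case: (odd u); case: (odd w); case: leqP.
Qed.

Lemma centre_star k u w : (k < uphalf n)%N -> w./2 = k ->
  side k u = side k w -> centre k u = w.
Proof.
move=> kn wk /eqP; rewrite side_parity // => /eqP uw; apply: val_inj.
by rewrite val_insubd (ltn_eqF kn) -uw -wk addnC odd_double_half ltn_ord.
Qed.

Lemma centre_neq k u : (k < uphalf n)%N -> u != centre k u ->
  [/\ (centre k u)./2 = k, side k u = side k (centre k u) & u./2 != k].
Proof.
move=> kn ucu; have uk : u./2 != k.
  by apply: contraNneq ucu => uk; rewrite (centre_star (w := u)).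
(* Since [u] is not its own centre, [insubd] did not return its default. *)
have cE : centre k u = (odd u (+) (u./2 < k) + k.*2)%N :> nat.
  move: ucu; rewrite -val_eqE /= val_insubd (ltn_eqF kn) addnC.
  by case: ifP; rewrite ?eqxx.
have ck : (centre k u)./2 = k by rewrite cE half_bit_double.
split=> //; apply/eqP; rewrite side_parity // cE oddD odd_double addbF.
by case: (_ (+) _).
Qed.

Lemma colour_of_side k (u v : nat) : u./2 = k -> v./2 != k ->
  side k v = side k u -> colour u v = k.
Proof.
rewrite /colour /side => -> vk; rewrite leqnn eq_sym (negbTE vk).
by case: (ltngtP k v./2) vk => // kv _; case: (odd u); case: (odd v).
Qed.

Lemma matching_star_forest : star_forest (colour_class (uphalf n)).
Proof.
apply: (@center_star_forest _ _ (centre (uphalf n))) => [u v|u v|u].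
- rewrite adj_colour => /andP[_ /eqP/colour_matching uv].
  by apply: val_inj; rewrite /= !centre_matching uv.
- rewrite adj_colour => /andP[u_v /eqP/colour_matching uv].
  (* The centres are the points [a_k], and no matching edge joins two odd vertices. *)
  have even_centre w : ~~ odd w -> w = centre (uphalf n) w.
    move=> /negbTE ow; apply: val_inj; rewrite /= centre_matching.
    by rewrite -{1}(odd_double_half w) ow.
  case ou: (odd u); last by left; apply: even_centre; rewrite ou.
  case ov: (odd v); last by right; apply: even_centre; rewrite ov.
  case/eqP: u_v; apply: val_inj => /=.
  by rewrite -(odd_double_half u) -(odd_double_half v) ou ov uv.
- rewrite adj_colour eq_sym => -> /=.
  by rewrite /colour centre_matching doubleK eqxx.
Qed.

Lemma double_star_forest k : (k < uphalf n)%N -> star_forest (colour_class k).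
Proof.
move=> kn; apply: (@center_star_forest _ _ (centre k)) => [u v|u v|u].
- rewrite adj_colour => /andP[_ /eqP/(colour_star kn)[uv []] wk].
    by rewrite (centre_star (w := u)) // (centre_star (w := u)).
  by rewrite (centre_star (w := v)) // (centre_star (w := v)).
- rewrite adj_colour => /andP[_ /eqP/(colour_star kn)[uv []] wk].
    by left; rewrite (centre_star (w := u)).
  by right; rewrite (centre_star (w := v)).
- move=> ucu; have [ck sc uk] := centre_neq kn ucu.
  by rewrite adj_colour eq_sym ucu /=; apply/eqP/colour_of_side.
Qed.

(** * Planarity of the colour classes *)

Variable R : realType.

Lemma segC (p q : 'rV[R]_2) (t : R) :
  (1 - t) *: p + t *: q = (1 - (1 - t)) *: q + (1 - t) *: p.
Proof. by rewrite addrC subKr. Qed.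

(** Edges on opposite sides are separated by [l_k]. Edges on the same side share the vertex of index
    [k] on that side, and two segments from a common end meet nowhere else by general position. *)
Lemma colour_star_plane k u v w z (t s : R) : (k < uphalf n)%N ->
  u != v -> w != z -> colour u v = k -> colour w z = k ->
  [set u; v] != [set w; z] -> 0 < t < 1 -> 0 < s < 1 ->
  (1 - t) *: pt R u + t *: pt R v <> (1 - s) *: pt R w + s *: pt R z.
Proof.
move=> kn uv wz cuv cwz ef t01 s01.
have onem01 (r : R) : 0 < r < 1 -> 0 < 1 - r < 1.
  by rewrite subr_gt0 gtrBl andbC.
have [suv] := colour_star kn cuv; have [swz] := colour_star kn cwz.
have [suw|suw _ _] := eqVneq (side k u) (side k w); last first.
  exact: seg_opposite_sides t01 s01 suv swz suw.
(* Reversing the segment, with [1 - t] for [t], makes its first end the vertex of index [k]. *)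
wlog uk : u v t uv cuv ef t01 suv suw / u./2 = k.
  move=> W wk [] uk; first by apply: W => //; left.
  rewrite segC; apply: W => //; rewrite 1?eq_sym 1?colourC ?onem01 -?suv //.
  - by rewrite eq_sym [[set v; u]]setUC.
  - by left.
move=> wk _.
wlog wk' : w z s wz cwz ef s01 swz suw wk / w./2 = k.
  move=> W; case: (wk) => wk'; first exact: W.
  rewrite [in X in _ <> X]segC.
  apply: W => //; rewrite 1?eq_sym 1?colourC ?onem01 -?swz //.
  - by rewrite setUC eq_sym.
  - by left.
(* Index and side together determine the parity, hence the vertex. *)
have uw : u = w.
  apply: val_inj; rewrite /= -(odd_double_half u) -(odd_double_half w) uk wk'.
  by move: suw; rewrite /side uk wk' leqnn !addbT => /negb_inj ->.
rewrite -{}uw in wz ef *; case/andP: s01 => s0 _.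
apply: seg_common_end => //; rewrite /= !inE negb_or uv wz !andbT /=.
by apply: contraNneq ef => /val_inj ->.
Qed.

Lemma colour_matching_plane u v w z (t s : R) :
  u != v -> w != z -> colour u v = uphalf n -> colour w z = uphalf n ->
  [set u; v] != [set w; z] -> 0 < t < 1 -> 0 < s < 1 ->
  (1 - t) *: pt R u + t *: pt R v <> (1 - s) *: pt R w + s *: pt R z.
Proof.
move=> uv wz /colour_matching huv /colour_matching hwz ef t01 s01.
have [uw|wu|uw] := ltngtP u./2 w./2; first exact: seg_pairs.
  by move/esym; exact: seg_pairs.
case/negP: ef; apply/eqP.
have [[uw' vz]|[uz vw]] : (u = w :> nat /\ v = z :> nat) \/
    (u = z :> nat /\ v = w :> nat).
- by move: uv wz; rewrite -!val_eqE /=; lia.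
- by rewrite (val_inj uw') (val_inj vz).
- by rewrite (val_inj uz) (val_inj vw) setUC.
Qed.

Lemma colour_plane k : plane (fun i : 'I_n => pt R i) (colour_class k).
Proof.
move=> e f eF fF [ef [x [[u [v [t [uv eE t01 xE]]]]]]].
move=> [w [z [s [wz fE s01 xE']]]].
move: eF fF ef xE; rewrite {}eE {}fE xE' !colour_class_pair //.
move=> /eqP cuv /eqP cwz ef /esym.
have [kn|kn|kn] := ltngtP k (uphalf n).
- exact: colour_star_plane cuv cwz ef t01 s01.
- by move: (colour_le u v); rewrite cuv leqNgt kn.
- by rewrite kn in cuv cwz; exact: colour_matching_plane.
Qed.

End Colouring.

(* [uphalf n] is the ceiling of n / 2. *)
Theorem theorem4 (R : realType) (n : nat) (hn : (0 < n)%N) :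
  exists p : 'I_n -> 'rV[R]_2, general_position p /\
    exists F : 'I_(uphalf n + 1)%N -> {set {set 'I_n}},
      edge_partition F /\ forall k, plane p (F k) /\ star_forest (F k).
Proof.
exists (fun i => pt R i); split; first exact: pt_general_position.
exists (fun k => colour_class n k); split; first exact: colour_partition.
move=> k; split; first exact: colour_plane.
have := ltn_ord k; rewrite {2}addn1 ltnS leq_eqVlt.
by case/predU1P=> [->|]; [exact: matching_star_forest|exact: double_star_forest].
Qed.
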